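(* Let $G$ be a graph (finite or infinite). Then: (i) $G$ is $\mathcal{F}$-convergent if and only if either $G$ is acyclic or $G$ has exactly one cycle, and that cycle has length $3$. (ii) If $G$ is $\mathcal{F}$-convergent, then it converges in at most two steps, i.e., $\mathcal{F}^n(G)\cong\mathcal{F}^2(G)$ for all $n\geq 2$.
   Context: All graphs are simple (no loops or multiple edges), labeled, and may be finite or infinite; cycles have finite length. A forest of $G$ is an acyclic subgraph of $G$; a maximal forest is a forest of $G$ not properly contained in any other forest of $G$. Let $\mathcal{N}(G)$ be the set of maximal forests of $G$. The forest graph $\mathcal{F}(G)$ has vertex set $\mathcal{N}(G)$, with two maximal forests $F_1,F_2$ adjacent iff they differ by exactly one edge, i.e., $F_2=F_1-e+f$ for some edges $e\in F_1$, $f\notin F_1$. Set $\mathcal{F}^0(G)=G$ and $\mathcal{F}^n(G)=\mathcal{F}(\mathcal{F}^{n-1}(G))$ for $n\geq1$. $G$ is $\mathcal{F}$-convergent if the set $\{\mathcal{F}^n(G):n\in\mathbb{N}\}$ is finite (up to isomorphism); otherwise it is $\mathcal{F}$-divergent. *)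

(* Defs.v *)
From mathcomp Require Import all_boot.
From Stdlib Require Import Classical.

Set Implicit Arguments.
Unset Strict Implicit.
Unset Printing Implicit Defensive.

Record graph := Graph {
  vertex :> Type;
  adj : vertex -> vertex -> Prop;
  adj_sym : forall x y, adj x y -> adj y x;
  adj_irrefl : forall x, ~ adj x x }.

(* [edge_rel a b] is the unordered pair {a, b}, as a symmetric relation. *)
Definition edge_rel (V : Type) (a b x y : V) : Prop :=
  (x = a /\ y = b) \/ (x = b /\ y = a).

(* All fields are Prop-valued, so under propositional and functional
   extensionality two subgraphs are equal iff they have the same vertices and
   the same edges. *)
Record subgraph (G : graph) := Subgraph {
  sub_vert : G -> Prop;
  sub_edge : G -> G -> Prop;
  sub_edge_sym : forall x y, sub_edge x y -> sub_edge y x;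
  sub_edge_adj : forall x y, sub_edge x y -> adj x y;
  sub_edge_vert : forall x y, sub_edge x y -> sub_vert x /\ sub_vert y }.

Definition contained (G : graph) (H K : subgraph G) : Prop :=
  (forall x, sub_vert H x -> sub_vert K x) /\
  (forall x y, sub_edge H x y -> sub_edge K x y).

(* Cycles are subgraphs, so different choices of starting point and direction
   of traversal [c] give the same cycle; [ordS] is the cyclic successor. *)
Definition cycle_of_length (G : graph) (n : nat) (C : subgraph G) : Prop :=
  2 < n /\
  exists c : 'I_n -> G,
    [/\ injective c,
        forall x, sub_vert C x <-> exists i, x = c i
      & forall x y, sub_edge C x y <-> exists i, edge_rel (c i) (c (ordS i)) x y].

Definition is_cycle (G : graph) (C : subgraph G) : Prop :=
  exists n, cycle_of_length n C.

Definition acyclic (G : graph) : Prop := forall C : subgraph G, ~ is_cycle C.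

Definition forest (G : graph) (F : subgraph G) : Prop :=
  forall C : subgraph G, contained C F -> ~ is_cycle C.

Definition maximal_forest (G : graph) (F : subgraph G) : Prop :=
  forest F /\ forall F' : subgraph G, forest F' -> contained F F' -> F' = F.

(* F2 = F1 - e + f with e = {a, b} an edge of F1 and f = {c, d} an edge of G
   not in F1. *)
Definition edge_exchange (G : graph) (F1 F2 : subgraph G) : Prop :=
  exists a b c d : G,
    [/\ sub_edge F1 a b,
        adj c d /\ ~ sub_edge F1 c d,
        forall x, sub_vert F2 x <-> sub_vert F1 x
      & forall x y, sub_edge F2 x y <->
          (sub_edge F1 x y /\ ~ edge_rel a b x y) \/ edge_rel c d x y].

Lemma edge_exchange_sym (G : graph) (F1 F2 : subgraph G) :
  edge_exchange F1 F2 -> edge_exchange F2 F1.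
Proof.
case=> a [b [c [d [Fab [Gcd nFcd] EV EE]]]]; exists c, d, a, b.
have edgeP (H : subgraph G) u v x y :
    sub_edge H u v -> edge_rel u v x y -> sub_edge H x y.
  by move=> Huv [[-> ->]|[-> ->]] //; apply: sub_edge_sym.
have relC (u v x y : G) : edge_rel u v x y -> edge_rel x y u v.
  by move=> [[-> ->]|[-> ->]]; [left | right].
split.
- by apply/EE; right; left.
- split; first exact: sub_edge_adj Fab.
  case/EE=> [[_ []]|cdab]; first by left.
  by apply: nFcd; apply: edgeP Fab (relC _ _ _ _ cdab).
- by move=> x; split=> /EV.
- move=> x y; split=> [Fxy|[[/EE[[]|] //]|]].
  + case: (classic (edge_rel a b x y)) => [|nab]; first by right.
    left; split; first by apply/EE; left.
    by move=> cdxy; apply: nFcd; apply: edgeP Fxy (relC _ _ _ _ cdxy).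
  + exact: edgeP Fab.
Qed.

Lemma edge_exchange_irrefl (G : graph) (F : subgraph G) : ~ edge_exchange F F.
Proof.
by case=> a [b [c [d [_ [_ nFcd] _ EE]]]]; apply/nFcd/EE; right; left.
Qed.

Definition forest_graph (G : graph) : graph :=
  @Graph {F : subgraph G | maximal_forest F}
    (fun F1 F2 => edge_exchange (proj1_sig F1) (proj1_sig F2))
    (fun F1 F2 => @edge_exchange_sym G (proj1_sig F1) (proj1_sig F2))
    (fun F => @edge_exchange_irrefl G (proj1_sig F)).

Definition iter_forest_graph (n : nat) (G : graph) : graph :=
  iter n forest_graph G.

Definition isomorphic (G H : graph) : Prop :=
  exists f : G -> H, bijective f /\ forall x y, adj x y <-> adj (f x) (f y).

(* Finitely many graphs represent all the F^n(G) up to isomorphism. *)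
Definition F_convergent (G : graph) : Prop :=
  exists (k : nat) (H : 'I_k -> graph),
    forall n, exists i, isomorphic (iter_forest_graph n G) (H i).

(* Main.v *)
Require Import Defs.
From mathcomp Require Import all_boot.
From mathcomp Require Import boolp classical_sets.

Set Implicit Arguments.
Unset Strict Implicit.
Unset Printing Implicit Defensive.

(** If the graph is acyclic then its only maximal forest is the graph itself; if
  its only cycle is a triangle then the maximal forests are obtained by removing
  one edge of the triangle, and the forest graph is [K3].

  Otherwise, two edges are missed by some maximal forest of the graph, or of its
  forest graph (which contains [K4] when the graph has a cycle of length at
  least 4). Every edge missed by a maximal forest [t] gives a triangle
  [t, t - e1 + f, t - e2 + f] in the forest graph, where [e1] and [e2] lie on the
  fundamental cycle of [f]; so [X] missed edges give a windmill of [X]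
  triangles sharing [t]. Choosing independently a path in each blade, one gets
  exponentially many vertex-disjoint triangles in the forest graph of the forest
  graph, hence exponentially many edges missed by any of its maximal forests.

  Convergence makes some iterate [H] isomorphic to its own iterates, so iterated
  power sets of the set [X] of edges missed by a maximal forest of [H] embed into
  [H * H]. But every vertex of [H] lies in a triangle, so [H] embeds into
  [X * 'I_3], contradicting Cantor's theorem. This argument applies to finite
  and infinite graphs alike. *)

(** * Connectivity and bridges *)

Section Connectivity.
Variable V : Type.
Implicit Types (R : V -> V -> Prop) (a b c d x y z : V).

Definition sym R := forall x y, R x y -> R y x.

Inductive conn R : V -> V -> Prop :=
| conn_refl x : conn R x x
| conn_step x y z : R x y -> conn R y z -> conn R x z.

Definition del R a b x y := R x y /\ ~ edge_rel a b x y.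
Definition add R a b x y := R x y \/ edge_rel a b x y.

(* For symmetric irreflexive [R]: every edge is a bridge. *)
Definition bridged R := forall x y, R x y -> ~ conn (del R x y) x y.

Lemma edge_relC a b x y : edge_rel a b x y -> edge_rel a b y x.
Proof. by case=> [[-> ->]|[-> ->]]; [right|left]. Qed.

Lemma edge_rel_flip a b x y : edge_rel a b x y -> edge_rel x y a b.
Proof. by case=> [[-> ->]|[-> ->]]; [left|right]. Qed.

Lemma edge_rel_swap a b x y : edge_rel a b x y -> edge_rel b a x y.
Proof. by case=> [[-> ->]|[-> ->]]; [right|left]. Qed.

Lemma edge_rel_refl a b : edge_rel a b a b.
Proof. by left. Qed.

Lemma edge_rel_sym R a b x y : sym R -> edge_rel a b x y -> R a b -> R x y.
Proof. by move=> sR [[-> ->]|[-> ->]] //; apply: sR. Qed.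

Lemma conn1 R x y : R x y -> conn R x y.
Proof. by move=> Rxy; apply: conn_step Rxy (conn_refl _ _). Qed.

Lemma conn_trans R x y z : conn R x y -> conn R y z -> conn R x z.
Proof. by elim=> // {}x u {}y Rxu _ IH /IH; apply: conn_step. Qed.

Lemma conn_sym R : sym R -> sym (conn R).
Proof.
move=> sR x y; elim=> [z|{}x z {}y Rxz _ IH]; first exact: conn_refl.
by apply: conn_trans IH _; apply/conn1/sR.
Qed.

Lemma conn_mono R R' x y :
  (forall u v, R u v -> conn R' u v) -> conn R x y -> conn R' x y.
Proof.
move=> sub; elim=> [z|{}x z {}y Rxz _]; first exact: conn_refl.
by apply: conn_trans; apply: sub.
Qed.

Lemma conn_sub R R' x y :
  (forall u v, R u v -> R' u v) -> conn R x y -> conn R' x y.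
Proof. by move=> sub; apply: conn_mono => u v /sub; apply: conn1. Qed.

Lemma conn_closed R (S : V -> Prop) x y :
  (forall u v, R u v -> S u -> S v) -> conn R x y -> S x -> S y.
Proof. by move=> clS; elim=> // {}x u {}y Rxu _ IH /(clS _ _ Rxu). Qed.

Lemma del_sym R a b : sym R -> sym (del R a b).
Proof. by move=> sR x y [/sR Ryx nab]; split=> // /edge_relC. Qed.

Lemma add_sym R a b : sym R -> sym (add R a b).
Proof. by move=> sR x y [/sR|/edge_relC]; [left|right]. Qed.

(** Only the last crossing of the new edge matters: a walk that uses it several times can be
    shortened to use it at most once. *)
Lemma conn_add R a b x y : sym R -> conn (add R a b) x y ->
  [\/ conn R x y, conn R x a /\ conn R b y | conn R x b /\ conn R a y].
Proof.
move=> sR; elim=> [z|{}x z {}y xz _]; first by constructor 1; apply: conn_refl.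
case: xz => [xz|[[-> ->]|[-> ->]]].
- case=> [zy|[za ?]|[zb ?]]; [constructor 1|constructor 2|constructor 3];
    by [apply: conn_step xz _ | split=> //; apply: conn_step xz _].
- case=> [zy|[za ?]|[zb ?]]; first by constructor 2; split=> //; apply: conn_refl.
    by constructor 2; split=> //; apply: conn_refl.
  by constructor 1.
- case=> [zy|[za ?]|[zb ?]]; first by constructor 3; split=> //; apply: conn_refl.
    by constructor 1.
  by constructor 3; split=> //; apply: conn_refl.
Qed.

Lemma del_addK R a b x y : R x y -> add (del R a b) a b x y.
Proof.
by move=> Rxy; case: (pselect (edge_rel a b x y)) => ?; [right|left; split].
Qed.

Lemma conn_del R a b x y : sym R -> conn R x y ->
  [\/ conn (del R a b) x y,
      conn (del R a b) x a /\ conn (del R a b) b y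
    | conn (del R a b) x b /\ conn (del R a b) a y].
Proof.
move=> sR xy; apply: conn_add; first exact: del_sym.
by apply: conn_sub xy => u v; apply: del_addK.
Qed.

Lemma bridged_sub R R' : (forall x y, R x y -> R' x y) -> bridged R' -> bridged R.
Proof.
move=> sub bR' x y /[dup] /sub R'xy _ con; apply: (bR' _ _ R'xy).
by apply: conn_sub con => u v [/sub].
Qed.

(** A detour around an old edge would have to cross the new one, and would then connect [a] to [b]
    inside [R]. *)
Lemma bridged_add R a b :
  sym R -> bridged R -> ~ conn R a b -> bridged (add R a b).
Proof.
move=> sR bR nab x y [Rxy|xy] con.
  case: (@conn_add (del R x y) a b x y (del_sym sR)).
  - by apply: conn_sub con => u v [[Ruv|?] ?]; [left|right].
  - exact: bR.
  - move=> [xa by_]; apply: nab; apply: conn_trans (_ : conn R a x) _.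
      by apply: (conn_sym sR); apply: conn_sub xa => u v [].
    apply: conn_step Rxy _; apply: (conn_sym sR).
    by apply: conn_sub by_ => u v [].
  - move=> [xb ay]; apply: nab; apply: conn_trans (_ : conn R a y) _.
      by apply: conn_sub ay => u v [].
    apply: conn_step (sR _ _ Rxy) _.
    by apply: conn_sub xb => u v [].
apply: nab; have {}con : conn R x y.
  apply: conn_sub con => u v [[//|ab] []].
  by case: xy => [[-> ->]|[-> ->]] //; apply: edge_rel_swap.
by case: xy con => [[-> ->]|[-> ->]] //; apply: (conn_sym sR).
Qed.

(* Walks are indexed by [nat]; only the values [g 0 .. g n] matter. *)
Lemma conn_path R x y : conn R x y ->
  exists (n : nat) (g : nat -> V),
    [/\ g 0 = x, g n = y, forall k, k < n -> R (g k) (g k.+1)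
      & forall i j, i <= n -> j <= n -> g i = g j -> i = j].
Proof.
move=> con; pose P x n (g : nat -> V) :=
  [/\ g 0 = x, g n = y & forall k, k < n -> R (g k) (g k.+1)].
have exW : exists n, `[< exists g, P x n g >].
  rewrite /P; elim: con => [z|{}x z y' Rxz _ [n /asboolP [g [g0 gn gS]]]].
    by exists 0; apply/asboolP; exists (fun=> z).
  exists n.+1; apply/asboolP; exists (fun k => if k is k'.+1 then g k' else x).
  by split=> // [[_|k]]; [rewrite /= g0 | apply: gS].
(* A walk of least length repeats no vertex: if [g i = g j] with [i < j], skipping the part from [i]
   to [j] gives a shorter walk. *)
case: (ex_minnP exW) => n /asboolP [g [g0 gn gS]] nmin.
exists n, g; split=> //.
suff inj i j : i < j -> j <= n -> g i <> g j.
  move=> i j ni nj gij; case: (ltngtP i j) => // [ij|ji].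
    by case: (inj _ _ ij nj).
  by case: (inj _ _ ji ni).
move=> ij nj gij; have := nmin (n - (j - i)); rewrite leqNgt.
have -> : n - (j - i) < n.
  by rewrite ltn_subrL subn_gt0 ij (leq_ltn_trans _ (leq_trans ij nj)).
move=> /= H; apply: (notF (H _)); apply/asboolP.
have E : (n - (j - i)) + (j - i) = n by rewrite subnK // (leq_trans (leq_subr _ _)).
exists (fun k => if k <= i then g k else g (k + (j - i))); split=> //.
- case: leqP => [le|_]; last by rewrite E.
  have ei : n - (j - i) = i.
    apply/eqP; rewrite eqn_leq le /= -(leq_add2r (j - i)) E subnKC //.
    exact: ltnW.
  have nj' : n = j by rewrite -E ei subnKC // ltnW.
  by rewrite ei gij -nj'.
- move=> k kn; have k2 : k + (j - i) < n by rewrite -[X in _ < X]E ltn_add2r.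
  case: (ltngtP k i) => [ki|ki|ki].
  + by apply: gS; apply: ltn_trans ki (leq_trans ij nj).
  + by rewrite addSn; apply: gS.
  + rewrite ki gij addSn subnKC; last exact: ltnW.
    by apply: gS; move: k2; rewrite ki subnKC // ltnW.
Qed.

End Connectivity.

(** * Cycles *)

Definition inj_upto V (n : nat) (g : nat -> V) :=
  forall i j, i <= n -> j <= n -> g i = g j -> i = j.

(** Any edge of a cycle can serve as its closing edge, the others then forming a path from [g 0] to
    [g n]. *)
Lemma cycle_rotate (G : graph) n (C : subgraph G) x y :
  cycle_of_length n.+1 C -> sub_edge C x y ->
  exists g : nat -> G,
    [/\ inj_upto n g, edge_rel (g n) (g 0) x y
      & forall u v, sub_edge C u v <->
          (exists2 k, k < n & edge_rel (g k) (g k.+1) u v) \/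
          edge_rel (g n) (g 0) u v].
Proof.
move=> [_ [c [cinj _ cE]]] /cE [i cxy].
(* The shift by [i.+1] sends position [n] to the index [i] of the chosen edge. *)
pose h k : 'I_n.+1 := inord ((k + i.+1) %% n.+1).
have hE k : h k = (k + i.+1) %% n.+1 :> nat by rewrite inordK // ltn_mod.
have hS k : ordS (h k) = h k.+1.
  by apply: val_inj => /=; rewrite !hE -addn1 modnDml addn1 addSn.
have hn : h n = i.
  by apply: val_inj => /=; rewrite hE addnS -addSn modnDl modn_small.
have h0 : h 0 = ordS i by rewrite -hn hS; apply: val_inj => /=; rewrite !hE modnDl.
exists (fun k => c (h k)); split.
- move=> j k jn kn /cinj /(congr1 (@nat_of_ord _)); rewrite !hE => /eqP.
  by rewrite eqn_modDr !modn_small // => /eqP.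
- by rewrite hn h0.
move=> u v; split=> [/cE [j cuv]|].
  pose k := (j + (n.+1 - i.+1)) %% n.+1.
  have kn : k < n.+1 by rewrite ltn_mod.
  have hk : h k = j.
    apply: val_inj => /=; rewrite hE modnDml -addnA subnK; last exact: ltn_ord.
    by rewrite modnDr modn_small.
  move: kn; rewrite ltnS leq_eqVlt => /orP [/eqP kn|kn].
    have ij : i = j by rewrite -hn -hk kn.
    by right; rewrite hn h0 ij.
  by left; exists k => //; rewrite -hS hk.
case=> [[k _ kuv]|uv]; apply/cE; first by exists (h k); rewrite hS.
by exists i; rewrite hn h0 in uv.
Qed.

Lemma cycle_make (G : graph) n (g : nat -> G) :
  1 < n -> inj_upto n g -> (forall k, k < n -> adj (g k) (g k.+1)) ->
  adj (g n) (g 0) ->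
  exists C : subgraph G,
    cycle_of_length n.+1 C /\
    forall u v, sub_edge C u v ->
      (exists2 k, k < n & edge_rel (g k) (g k.+1) u v) \/
      edge_rel (g n) (g 0) u v.
Proof.
move=> n1 ginj gS gn0.
pose c (i : 'I_n.+1) := g i.
pose E x y := exists i, edge_rel (c i) (c (ordS i)) x y.
have cS (i : 'I_n.+1) :
    (i < n /\ c (ordS i) = g i.+1) \/ (i = n :> nat /\ c (ordS i) = g 0).
  have := ltn_ord i; rewrite ltnS leq_eqVlt => /orP [/eqP i_n|i_n].
    by right; split=> //; rewrite /c /= i_n modnn.
  by left; split=> //; rewrite /c /= modn_small.
have Esym x y : E x y -> E y x by case=> i ixy; exists i; apply: edge_relC.
have Eadj x y : E x y -> adj x y.
  move=> [i xy]; apply: (edge_rel_sym (@adj_sym G) xy).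
  by case: (cS i) => [[i_n ->]|[i_n ->]]; [apply: gS | rewrite /c i_n].
pose S x := exists i, x = c i.
have ES x y : E x y -> S x /\ S y.
  by case=> i [[-> ->]|[-> ->]]; split; eexists.
exists (Subgraph Esym Eadj ES); split.
  split; first by [].
  exists c; split=> // i j cij; apply: val_inj; apply: ginj cij.
    by rewrite -ltnS.
  by rewrite -ltnS.
move=> u v [i]; case: (cS i) => [[i_n ->]|[i_n ->]] uv.
  by left; exists i.
by right; rewrite /c i_n in uv.
Qed.

Lemma path_conn V (R : V -> V -> Prop) (g : nat -> V) i j : i <= j ->
  (forall k, i <= k < j -> R (g k) (g k.+1)) -> conn R (g i) (g j).
Proof.
elim: j => [|j IH]; first by rewrite leqn0 => /eqP -> _; apply: conn_refl.
rewrite leq_eqVlt => /orP [/eqP -> _|]; first exact: conn_refl.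
rewrite ltnS => ij gR; apply: conn_trans (IH ij _) _.
  by move=> k /andP [ik kj]; apply: gR; rewrite ik ltnW.
by apply/conn1/gR; rewrite ij /=.
Qed.

(** For [n = 1] the closing edge would be the only edge of the path, whence the bound on [n]. *)
Lemma closing_edge V n (g : nat -> V) k : 1 < n -> inj_upto n g -> k < n ->
  ~ edge_rel (g n) (g 0) (g k) (g k.+1).
Proof.
move=> n2 ginj kn [[/ginj e _]|[/ginj e1 /ginj e2]].
  by move: (kn); rewrite e ?ltnn // ltnW.
by have := e2 kn (leqnn _); rewrite (e1 (ltnW kn) _) // => n1; rewrite -n1 in n2.
Qed.

Lemma cycle_connect (G : graph) (C : subgraph G) x y :
  is_cycle C -> sub_edge C x y -> conn (del (sub_edge C) x y) x y.
Proof.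
move=> [[|n] Cn] Cxy; first by case: Cn.
have n2 : 1 < n by case: Cn.
have [g [ginj xy CE]] := cycle_rotate Cn Cxy.
have con : conn (del (sub_edge C) x y) (g 0) (g n).
  apply: path_conn => // k kn; split.
    by apply/CE; left; exists k => //; apply: edge_rel_refl.
  move=> xyk; apply: (closing_edge n2 ginj kn).
  by case: xy xyk => [[-> ->]|[-> ->]] // H; apply: edge_rel_swap.
case: xy con => [[-> ->]|[-> ->]] // con.
apply: (conn_sym _ con); apply: del_sym; apply: (@sub_edge_sym _ C).
Qed.

(** Without [x y] the cycle is a path between these two vertices, and deleting a further edge cuts
    this path. *)
Lemma cycle_disconnect (G : graph) (C : subgraph G) x y a b :
  is_cycle C -> sub_edge C x y -> sub_edge C a b -> ~ edge_rel x y a b ->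
  ~ conn (del (del (sub_edge C) x y) a b) x y.
Proof.
move=> [[|n] Cn] Cxy Cab nab; first by case: Cn.
have n2 : 1 < n by case: Cn.
have [g [ginj xy CE]] := cycle_rotate Cn Cxy.
have sC : sym (del (del (sub_edge C) x y) a b).
  by do 2 apply: del_sym; apply: (@sub_edge_sym _ C).
suff : ~ conn (del (del (sub_edge C) x y) a b) (g 0) (g n).
  move=> H con; apply: H; case: xy => [[ex ey]|[ex ey]]; rewrite -ex -ey //.
  exact: (conn_sym sC con).
have rel_trans p q : edge_rel (g n) (g 0) p q -> edge_rel x y p q.
  by case: xy => [[-> ->]|[-> ->]] // H; apply: edge_rel_swap.
have [j jn jab] : exists2 j, j < n & edge_rel (g j) (g j.+1) a b.
  by case: (iffLR (CE _ _) Cab) => // /rel_trans.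
move=> con.
(* The initial segment [g 0], ..., [g j] is closed under the remaining edges and does not contain
   [g n]. *)
have [] := @conn_closed _ _ (fun u => exists2 k, k <= j & u = g k) _ _ _ con.
- move=> u v [[Cuv nuv] nabuv] [k kj uk].
  case: (iffLR (CE _ _) Cuv) => [[i i_n]|/rel_trans //].
  case=> [[ui vi]|[ui vi]].
    have ki : k = i.
      by apply: ginj; rewrite -?uk -?ui ?(ltnW i_n) // (leq_trans kj (ltnW jn)).
    exists k.+1; last by rewrite vi ki.
    rewrite ltn_neqAle kj andbT; apply/eqP => kj'; apply: nabuv.
    rewrite ui vi -ki kj'; exact: edge_rel_flip.
  have ki : k = i.+1.
    by apply: ginj; rewrite -?uk -?ui // (leq_trans kj (ltnW jn)).
  by exists i => //; rewrite ltnW // -ki.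
- by exists 0.
- move=> k kj /ginj e; have := e (leqnn _) (leq_trans kj (ltnW jn)).
  by move=> nk; move: jn; rewrite nk ltnNge kj.
Qed.

(** A simple path bypassing an edge closes up to a cycle with it, and an edge of a cycle is bypassed
    by the rest of the cycle. From here on acyclicity can be handled through [conn] alone. *)
Lemma forest_bridged (G : graph) (F : subgraph G) :
  forest F <-> bridged (sub_edge F).
Proof.
split=> [fF x y Fxy con|bF C [_ CF] cC].
  have [n [g [g0 gn gS ginj]]] := conn_path con.
  have [||k kn||C [Cn CE]] := @cycle_make G n g.
  (* Length 0 would make the edge a loop, and length 1 would use the deleted edge itself. *)
  - case: n gn gS {ginj con} => [|[|//]] gn gS.
      by case: (@adj_irrefl G x); rewrite -{2}g0 gn; apply: sub_edge_adj Fxy.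
    by have := gS 0 isT; rewrite g0 gn => -[_ []]; apply: edge_rel_refl.
  - exact: ginj.
  - by have [/sub_edge_adj] := gS _ kn.
  - by rewrite g0 gn; apply/sub_edge_adj/sub_edge_sym/Fxy.
  apply: (fF C); last by exists n.+1.
  have CF u v : sub_edge C u v -> sub_edge F u v.
    move=> /CE [[k kn]|] /(edge_rel_sym (@sub_edge_sym _ F)); apply.
      by have [] := gS _ kn.
    by rewrite g0 gn; apply/sub_edge_sym/Fxy.
  split=> // u; case: Cn => _ [c [_ cV cE]] /cV [i ->].
  have /CF /sub_edge_vert [] // : sub_edge C (c i) (c (ordS i)).
  by apply/cE; exists i; apply: edge_rel_refl.
have [n Cn] := cC; case: n Cn => [[//]|n] Cn.
have [n2 [c [_ _ cE]]] := Cn.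
have Cxy : sub_edge C (c ord0) (c (ordS ord0)).
  by apply/cE; exists ord0; apply: edge_rel_refl.
apply: (bF _ _ (CF _ _ Cxy)); have := cycle_connect cC Cxy.
by apply: conn_sub => u v [/CF].
Qed.

(** * Maximal forests *)

(** The condition bears on edges only, since a maximal forest contains every vertex; the last clause
    says that each component of the graph is spanned. *)
Definition spanning_forest (G : graph) (R : G -> G -> Prop) :=
  [/\ sym R, forall x y, R x y -> adj x y, bridged R
    & forall x y, adj x y -> conn R x y].

Definition edges (G : graph) (t : forest_graph G) : G -> G -> Prop :=
  sub_edge (proj1_sig t).

Lemma subgraph_ext (G : graph) (F F' : subgraph G) :
  (forall x, sub_vert F x <-> sub_vert F' x) ->
  (forall x y, sub_edge F x y <-> sub_edge F' x y) -> F = F'.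
Proof.
case: F => V E s a v; case: F' => V' E' s' a' v' /= /predeqP VV /predeq2P EE.
subst V' E'; congr Subgraph; exact: Prop_irrelevance.
Qed.

(** By maximality, no vertex is left out and no edge joins two components of the forest. Conversely,
    an edge added to a spanning forest is bypassed by the forest, hence is no bridge. *)
Lemma maximal_forestP (G : graph) (F : subgraph G) :
  maximal_forest F <->
  (forall x, sub_vert F x) /\ spanning_forest (sub_edge F).
Proof.
have sF := @sub_edge_sym _ F; have aF := @sub_edge_adj _ F.
split=> [[/forest_bridged bF maxF]|[allF [_ _ bF conF]]].
  split=> [x|].
    pose F' := @Subgraph G (fun=> True) _ sF aF (fun _ _ _ => conj I I).
    by rewrite -(maxF F') //; apply/forest_bridged.
  split=> // x y xy; apply: contrapT => nxy; apply: (nxy).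
  have sR := add_sym (a := x) (b := y) sF.
  have aR u v : add (sub_edge F) x y u v -> adj u v.
    by case=> [/aF //|/(edge_rel_sym (@adj_sym G))]; apply.
  pose F' := @Subgraph G (fun=> True) _ sR aR (fun _ _ _ => conj I I).
  apply: conn1; rewrite -(maxF F'); first by right; apply: edge_rel_refl.
    by apply/forest_bridged/bridged_add.
  by split=> // u v; left.
split; first exact/forest_bridged.
move=> F' /forest_bridged bF' [VF' EF']; apply: subgraph_ext => [x|x y].
  by split=> // _; apply/VF'/allF.
split=> [|/EF' //] F'xy; apply: contrapT => nFxy.
apply: (bF' _ _ F'xy); have := conF _ _ (sub_edge_adj F'xy).
apply: conn_sub => u v Fuv; split; first exact: EF'.
by move=> xy; apply: nFxy; apply: edge_rel_sym sF (edge_rel_flip xy) Fuv.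
Qed.

Lemma edges_spanning (G : graph) (t : forest_graph G) : spanning_forest (edges t).
Proof. by case: t => F mF; have [_] := iffLR (maximal_forestP F) mF. Qed.

Lemma edges_inj (G : graph) (t t' : forest_graph G) :
  (forall x y, edges t x y <-> edges t' x y) -> t = t'.
Proof.
case: t t' => [F mF] [F' mF']; rewrite /edges /= => EE.
apply: eq_exist; apply: subgraph_ext => // x.
by have [aF _] := iffLR (maximal_forestP F) mF;
   have [aF' _] := iffLR (maximal_forestP F') mF'.
Qed.

Lemma spanning_edges (G : graph) (R : G -> G -> Prop) :
  spanning_forest R -> exists t : forest_graph G, edges t = R.
Proof.
move=> sfR; have [sR aR _ _] := sfR.
pose F := @Subgraph G (fun=> True) R sR aR (fun _ _ _ => conj I I).
have mF : maximal_forest F by apply/maximal_forestP.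
by exists (exist _ F mF).
Qed.

(** * Exchanging one edge of a maximal forest *)

Definition swap V (R : V -> V -> Prop) (a b c d : V) := add (del R a b) c d.

Lemma forest_adjP (G : graph) (t t' : forest_graph G) :
  adj t t' <-> exists a b c d, [/\ edges t a b, adj c d, ~ edges t c d
    & forall x y, edges t' x y <-> swap (edges t) a b c d x y].
Proof.
split=> [[a [b [c [d [tab [cd ntcd] _ E]]]]]|[a [b [c [d [tab cd ntcd E]]]]]].
  by exists a, b, c, d.
exists a, b, c, d; split=> // x.
have [H _] := iffLR (maximal_forestP _) (proj2_sig t).
by have [H' _] := iffLR (maximal_forestP _) (proj2_sig t').
Qed.

(** The last hypothesis says that [a b] lies on the fundamental cycle of [c d]; the rest of this
    cycle, through [c d], reconnects [a] with [b]. *)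
Lemma exchange (G : graph) (t : forest_graph G) a b c d :
  edges t a b -> adj c d -> ~ edges t c d ->
  ~ conn (del (edges t) a b) c d ->
  exists2 t' : forest_graph G, edges t' = swap (edges t) a b c d & adj t t'.
Proof.
move=> tab cd ntcd ncon; have [sR aR bR cR] := edges_spanning t.
have sD := del_sym (a := a) (b := b) sR.
have sfS : spanning_forest (swap (edges t) a b c d).
  split.
  - exact: add_sym.
  - by move=> x y [[/aR //]|/(edge_rel_sym (@adj_sym G))]; apply.
  - by apply: bridged_add => //; apply: bridged_sub bR => x y [].
  - move=> x y /cR; apply: conn_mono => u v tuv.
    have sS : sym (swap (edges t) a b c d) by apply: add_sym.
    have DS p q : conn (del (edges t) a b) p q -> conn (swap (edges t) a b c d) p q.
      by apply: conn_sub => ? ?; left.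
    have ab : conn (swap (edges t) a b c d) a b.
      have cdS : conn (swap (edges t) a b c d) c d.
        by apply: conn1; right; apply: edge_rel_refl.
      case: (conn_del a b sR (cR _ _ cd)) => [//|[ca bd]|[cb ad_]].
        apply: conn_trans (conn_sym sS (DS _ _ ca)) _.
        exact: conn_trans cdS (conn_sym sS (DS _ _ bd)).
      apply: conn_trans (DS _ _ ad_) _.
      exact: conn_trans (conn_sym sS cdS) (DS _ _ cb).
    case: (del_addK a b tuv) => [D|[[-> ->]|[-> ->]]] //; first by apply: conn1; left.
    exact: (conn_sym sS).
have [t' t'E] := spanning_edges sfS; exists t' => //.
by apply/forest_adjP; exists a, b, c, d; split=> // x y; rewrite t'E.
Qed.

(** Both forests contain [c d], so [t2] arises from [t1] by dropping the second deleted edge and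
    restoring the first. *)
Lemma swap_adj (G : graph) (t t1 t2 : forest_graph G) a1 b1 a2 b2 c d :
  edges t a1 b1 -> edges t a2 b2 -> ~ edge_rel a1 b1 a2 b2 ->
  ~ edges t c d -> edges t1 = swap (edges t) a1 b1 c d ->
  edges t2 = swap (edges t) a2 b2 c d -> adj t1 t2.
Proof.
move=> T1 T2 n12 ncd E1 E2; have [sR aR _ _] := edges_spanning t.
have ncdT x y : edges t x y -> ~ edge_rel c d x y.
  by move=> txy cdxy; apply: ncd; apply: edge_rel_sym sR (edge_rel_flip cdxy) txy.
apply/forest_adjP; exists a2, b2, a1, b1; split.
- by rewrite E1; left.
- exact: aR.
- by rewrite E1 => -[[_ []]|/ncdT]; [apply: edge_rel_refl | apply].
move=> x y; rewrite E1 E2; split.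
  case=> [[Txy n2]|cd].
    by case: (pselect (edge_rel a1 b1 x y)) => ?; [right | left; split=> //; left].
  left; split; first by right.
  by move=> r2; apply: (ncdT x y) => //; apply: edge_rel_sym sR r2 T2.
case=> [[[[Txy _]|cd] n2]|r1]; [by left | by right | left; split].
  exact: edge_rel_sym sR r1 T1.
move=> r2; apply: n12; move: r1 r2 => [[-> ->]|[-> ->]] r.
  exact: edge_rel_flip.
exact: edge_rel_swap (edge_rel_flip r).
Qed.

(** If the ends stayed connected, this connection and the two remaining pieces of the path would
    bypass the deleted edge. *)
Lemma path_cut V (R : V -> V -> Prop) n (g : nat -> V) k :
  sym R -> bridged R -> inj_upto n g ->
  (forall i, i < n -> R (g i) (g i.+1)) -> k < n ->
  ~ conn (del R (g k) (g k.+1)) (g 0) (g n).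
Proof.
move=> sR bR ginj gR kn con; apply: (bR _ _ (gR k kn)).
have sD := del_sym (a := g k) (b := g k.+1) sR.
have step i : i < n -> i <> k -> del R (g k) (g k.+1) (g i) (g i.+1).
  move=> i_n ik; split; first exact: gR.
  case=> [[/ginj e _]|[/ginj e1 /ginj e2]]; first by apply: ik; apply: e; apply: ltnW.
  have e : k.+2 = k by rewrite -[RHS]e2 // ?(ltnW kn) // -(e1 (ltnW i_n) kn).
  by have := leqnSn k.+1; rewrite e ltnn.
apply: (conn_trans (y := g 0)).
  apply: (conn_sym sD); apply: path_conn => // i /andP [_ ik].
  by apply: step; [apply: ltn_trans kn | move=> e; rewrite e ltnn in ik].
apply: conn_trans con _; apply: (conn_sym sD); apply: path_conn => // i /andP [ki i_n].
by apply: step => // e; rewrite e ltnn in ki.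
Qed.

Lemma path_edge_inj V n (g : nat -> V) i j :
  inj_upto n g -> i < n -> j < n ->
  edge_rel (g i) (g i.+1) (g j) (g j.+1) -> i = j.
Proof.
move=> ginj i_n jn [[/ginj e _]|[/ginj e1 /ginj e2]].
  by rewrite e // ltnW.
have e : i.+2 = i by rewrite -[RHS]e2 // ?(ltnW i_n) // -(e1 (ltnW jn) i_n).
by have := leqnSn i.+1; rewrite e ltnn.
Qed.

Lemma path_two_cuts (G : graph) (t : forest_graph G) c d :
  adj c d -> ~ edges t c d ->
  exists a1 b1 a2 b2,
    [/\ edges t a1 b1, edges t a2 b2, ~ edge_rel a1 b1 a2 b2,
        ~ conn (del (edges t) a1 b1) c d & ~ conn (del (edges t) a2 b2) c d].
Proof.
move=> cd ncd; have [sR aR bR cR] := edges_spanning t.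
have [n [g [g0 gn gS ginj]]] := conn_path (cR _ _ cd).
have n2 : 1 < n.
  case: n gn gS {ginj} => [|[|//]] gn gS.
    by case: (@adj_irrefl G c); rewrite -{2}g0 gn.
  by have := gS 0 isT; rewrite g0 gn.
have n1 := ltnW n2.
exists (g 0), (g 1), (g 1), (g 2); split; try exact: gS.
- by move=> /(path_edge_inj ginj n1 n2).
- by rewrite -g0 -gn; apply: path_cut.
- by rewrite -g0 -gn; apply: path_cut.
Qed.

(** Zorn's lemma is applied to the sets of pairs whose union with [R] is still a forest; they may
    overlap [R], so the empty set is among them. *)
Lemma extend_forest (G : graph) (R : G -> G -> Prop) :
  sym R -> (forall x y, R x y -> adj x y) -> bridged R ->
  exists t : forest_graph G, forall x y, R x y -> edges t x y.
Proof.
move=> sR aR bR.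
pose U (S : set (G * G)) x y := R x y \/ S (x, y).
pose P S := [/\ sym (U S), forall x y, U S x y -> adj x y & bridged (U S)].
have P0 : P set0.
  split=> [x y [/sR|//]|x y [/aR|//] //|]; first by left.
  by apply: bridged_sub bR => x y [].
have chainP (F : set (set (G * G))) : (F `<=` P)%classic -> total_on F subset ->
    P (\bigcup_(X in F) X)%classic.
  (* Adjoining [set0] gives the edges of [R] a member to live in even when the chain [F] is
     empty. *)
  move=> FP totF; pose F' S := F S \/ S = set0.
  have F'P S : F' S -> P S by move=> [/FP|->].
  have UF' S : F' S -> (S `<=` \bigcup_(X in F) X)%classic.
    by move=> [FS|->] // x Sx; exists S.
  have F'U x y : U (\bigcup_(X in F) X)%classic x y -> exists2 S, F' S & U S x y.
    case=> [Rxy|[S FS Sxy]]; first by exists set0; [right | left].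
    by exists S; [left | right].
  have totF' S S' : F' S -> F' S' -> (S `<=` S')%classic \/ (S' `<=` S)%classic.
    by move=> [FS|->] [FS'|->]; [apply: totF | right | left | left].
  have UU S S' x y : (S `<=` S')%classic -> U S x y -> U S' x y.
    by move=> SS' [|/SS']; [left | right].
  split.
  - move=> x y /F'U [S F'S Sxy]; have [sS _ _] := F'P _ F'S.
    by apply: UU (sS _ _ Sxy); apply: UF'.
  - by move=> x y /F'U [S F'S Sxy]; have [_ aS _] := F'P _ F'S; apply: aS.
  - move=> x y /F'U [S F'S Sxy] con.
    (* A walk has finitely many edges, so it already lies in one member of the chain. *)
    have lift p q : conn (del (U (\bigcup_(X in F) X)%classic) x y) p q ->
        exists2 S', F' S' & (S `<=` S')%classic /\ conn (del (U S') x y) p q.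
      elim=> [z|u v w [/F'U [S1 F'S1 S1uv] nuv] _ [S2 F'S2 [SS2 con2]]].
        by exists S => //; split=> //; apply: conn_refl.
      case: (totF' _ _ F'S1 F'S2) => S12.
        exists S2 => //; split=> //; apply: (conn_step _ con2).
        by split=> //; apply: UU S1uv.
      exists S1 => //; split; first exact: subset_trans S12.
      apply: (conn_step (y := v)); first by split.
      by apply: conn_sub con2 => ? ? [? ?]; split=> //; apply: UU S12 _.
    have [S' F'S' [SS' con']] := lift _ _ con.
    by have [_ _ bS'] := F'P _ F'S'; apply: bS' con'; apply: UU Sxy.
have [A [[sA aA bA] maxA]] := Zorn_bigcup chainP.
have sfA : spanning_forest (U A).
  split=> // x y xy; apply: contrapT => nxy.
  pose B := (A `|` [set e | edge_rel x y e.1 e.2])%classic.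
  have UB u v : U B u v <-> add (U A) x y u v.
    by split=> [[?|[?|?]]|[[?|?]|?]];
      [left; left|left; right|right|left|right; left|right; right].
  apply: (maxA B); first split.
  - by move=> e; left.
  - move=> BA; apply: nxy; apply: conn1; right; apply: BA; right.
    exact: edge_rel_refl.
  - split.
    + by move=> u v /UB /(add_sym sA) /UB.
    + move=> u v /UB [/aA //|/(edge_rel_sym (@adj_sym G))]; exact.
    + by apply: bridged_sub (bridged_add sA bA nxy) => u v /UB.
have [t tE] := spanning_edges sfA.
by exists t => x y Rxy; rewrite tE; left.
Qed.

Lemma forest_graph_inhabited (G : graph) : inhabited (forest_graph G).
Proof. by have [|||t _] := @extend_forest G (fun _ _ => False); try move=> ? ?. Qed.

(** * Windmills of triangles *)

Definition ord31 : 'I_3 := @Ordinal 3 1 isT.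
Definition ord32 : 'I_3 := @Ordinal 3 2 isT.

Lemma ord3P (i : 'I_3) : [\/ i = ord0, i = ord31 | i = ord32].
Proof.
case: i => [[|[|[|//]]] h]; [constructor 1|constructor 2|constructor 3];
  exact: val_inj.
Qed.

Lemma ord3_third (i j : 'I_3) : exists k : 'I_3, i <> k /\ j <> k.
Proof.
by case: (ord3P i) => ->; case: (ord3P j) => ->;
  (try by exists ord0); (try by exists ord31); exists ord32.
Qed.

Definition tri3 V (a b c : V) (i : 'I_3) : V :=
  match val i with 0 => a | 1 => b | _ => c end.

Lemma tri3_adj (G : graph) (a b c : G) : adj a b -> adj a c -> adj b c ->
  forall i j, i <> j -> adj (tri3 a b c i) (tri3 a b c j).
Proof.
move=> ab ac bc i j; case: (ord3P i) => ->; case: (ord3P j) => -> // _;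
  by [|apply: adj_sym].
Qed.

(* Two distinct triangles may only share their vertices of index [0]; in
   particular they are edge-disjoint. *)
Definition triangle_family (G : graph) X (p : X -> 'I_3 -> G) :=
  (forall x i j, i <> j -> adj (p x i) (p x j)) /\
  (forall x x' i i', p x i = p x' i' -> x = x' \/ i = ord0).

(** For a finite graph, the number of edges missed by a maximal forest is the cyclomatic number.
    Indexing distinct missed edges by a type [X] bounds it below in the infinite case too. *)
Definition nullity_ge (G : graph) X :=
  exists (t : forest_graph G) (a b : X -> G),
    (forall x, adj (a x) (b x) /\ ~ edges t (a x) (b x)) /\
    (forall x x', edge_rel (a x) (b x) (a x') (b x') -> x = x').

Lemma bridged_triangle V (R : V -> V -> Prop) a b c :
  bridged R -> a <> b -> a <> c -> b <> c -> R a b -> R a c -> R c b -> False.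
Proof.
move=> bR ab ac bc Rab Rac Rcb; apply: (bR _ _ Rab).
apply: (@conn_step _ _ _ c); first by split=> // -[[_ /esym]|[]].
by apply: conn1; split=> // -[[/esym]|[/esym]].
Qed.

Lemma adj_neq (G : graph) (x y : G) : adj x y -> x <> y.
Proof. by move=> /[swap] -> /adj_irrefl. Qed.

Lemma triangle_family_inj (G : graph) X (p : X -> 'I_3 -> G) x :
  triangle_family p -> injective (p x).
Proof.
by move=> [pA _] i j e; apply: contrapT => /(pA x) /adj_neq.
Qed.

Lemma triangle_missing (G : graph) (p : 'I_3 -> G) (t : forest_graph G) :
  (forall i j, i <> j -> adj (p i) (p j)) ->
  exists i j, i <> j /\ ~ edges t (p i) (p j).
Proof.
move=> pA; apply: contrapT => nex.
have allE i j : i <> j -> edges t (p i) (p j).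
  by move=> ij; apply: contrapT => nE; apply: nex; exists i, j.
have [_ _ bt _] := edges_spanning t.
by apply: (@bridged_triangle _ _ (p ord0) (p ord31) (p ord32) bt);
  first [exact/adj_neq/pA | exact: allE].
Qed.

(** A forest misses an edge of every triangle, and these edges are distinct because the triangles
    are edge-disjoint. *)
Lemma triangles_nullity (G : graph) X (p : X -> 'I_3 -> G) :
  triangle_family p -> nullity_ge G X.
Proof.
move=> [pA pD].
have [t] := forest_graph_inhabited G.
have /choice [f fP] x := triangle_missing t (pA x).
have {fP} /choice [g gP] := fP.
exists t, (fun x => p x (f x)), (fun x => p x (g x)); split=> [x|x x'].
  by have [fg nE] := gP x; split=> //; apply: pA.
have H i' j' : p x' i' = p x (f x) -> p x' j' = p x (g x) -> x = x'.
  move=> /esym /pD [//|f0] /esym /pD [//|g0].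
  by have [[]] := gP x; rewrite f0 g0.
by case=> -[e1 e2]; apply: H e1 e2 || apply: H e2 e1.
Qed.

(** The last two clauses make [c d] recoverable: it is the one edge that the vertices of the
    triangle other than [t] have and [t] lacks. *)
Lemma forest_triangle (G : graph) (t : forest_graph G) c d :
  adj c d -> ~ edges t c d ->
  exists p : 'I_3 -> forest_graph G,
    [/\ p ord0 = t, forall i j, i <> j -> adj (p i) (p j),
      forall i, i <> ord0 -> edges (p i) c d
      & forall i u v, ~ edge_rel c d u v -> edges (p i) u v -> edges t u v].
Proof.
move=> cd ncd.
have [a1 [b1 [a2 [b2 [T1 T2 n12 cut1 cut2]]]]] := path_two_cuts cd ncd.
have [t1 E1 A1] := exchange T1 cd ncd cut1.
have [t2 E2 A2] := exchange T2 cd ncd cut2.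
exists (tri3 t t1 t2); split=> //.
- by apply: tri3_adj => //; apply: swap_adj T1 T2 n12 ncd E1 E2.
- by move=> i; case: (ord3P i) => -> // _; rewrite /tri3 /= (E1, E2); right;
    apply: edge_rel_refl.
- by move=> i u v nuv; case: (ord3P i) => ->; rewrite /tri3 /= ?(E1, E2) // => -[[]|].
Qed.

Lemma nullity_windmill (G : graph) X : nullity_ge G X ->
  exists (t : forest_graph G) (p : X -> 'I_3 -> forest_graph G),
    (forall x, p x ord0 = t) /\ triangle_family p.
Proof.
move=> [t [a [b [ab dist]]]].
have /choice [p pP] x := forest_triangle (proj1 (ab x)) (proj2 (ab x)).
exists t, p; split=> [x|]; first by have [] := pP x.
split=> [x i j|x x' i i' pe]; first by have [_ pA _ _] := pP x; apply: pA.
apply: contrapT => /not_orP [nx ni].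
have [_ _ pin _] := pP x; have [_ _ _ pout] := pP x'.
have [_] := ab x; apply; apply: (pout i'); first by move=> /dist /esym.
by rewrite -pe; apply: pin.
Qed.

(** On a cycle, a vertex of greatest rank would have two distinct neighbours, both of lower rank. *)
Lemma rank_bridged V (R : V -> V -> Prop) (rank : V -> nat) :
  sym R -> (forall u v, R u v -> rank u <> rank v) ->
  (forall u v w, R u v -> R u w -> rank v < rank u -> rank w < rank u -> v = w) ->
  bridged R.
Proof.
move=> sR rneq runiq x y Rxy con.
have {con} [n [g [g0 gn gS ginj]]] := conn_path con.
have n1 : 1 < n.
  case: n gn gS {ginj} => [|[|//]] gn gS.
    by case: (rneq _ _ Rxy); rewrite -gn g0.
  by have := gS 0 isT; rewrite g0 gn => -[_ []]; apply: edge_rel_refl.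
have gR k : k < n -> R (g k) (g k.+1) by move=> /gS [].
have gn0 : R (g n) (g 0) by rewrite gn g0; apply: sR.
have [m _ mmax] := @arg_maxnP 'I_n.+1 ord0 predT (fun i => rank (g i)) isT.
have low k : k <= n -> R (g m) (g k) -> rank (g k) < rank (g m).
  move=> kn /rneq ne; rewrite ltn_neqAle; apply/andP; split; first exact/eqP/nesym.
  exact: (mmax (Ordinal (kn : k < n.+1)) isT).
have uniq k l : k <= n -> l <= n -> R (g m) (g k) -> R (g m) (g l) -> k = l.
  by move=> kn ln Rk Rl; apply: ginj => //; apply: runiq (Rk) (Rl) _ _; apply: low.
(* The cyclic neighbours of position [m] are [n.-1] and [0] if [m = n], [1] and [n] if [m = 0], and
   [m.-1] and [m.+1] otherwise. *)
have := ltn_ord m; rewrite ltnS leq_eqVlt => /orP [/eqP mn|mn].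
  have : n.-1 = 0.
    apply: uniq; rewrite ?leq_pred ?mn //; apply: sR.
    by have := gR n.-1; rewrite prednK ?leqnn ?(ltnW n1) //; apply.
  by case: n n1 {gn gS ginj gR gn0 m mmax low uniq mn} => [|[]].
case: (posnP m) => [m0|m_gt0].
  have e : 1 = n.
    apply: uniq; rewrite ?m0 ?leqnn ?(ltnW n1) //; first by apply: gR; apply: ltnW.
    exact: sR.
  by rewrite -e in n1.
have : m.-1 = m.+1.
  apply: uniq => //; first by rewrite (leq_trans (leq_pred _)) // ltnW.
  - by apply: sR; have := gR m.-1; rewrite prednK //; apply; apply: ltnW.
  - exact: gR.
move=> e; have := leq_pred m; by rewrite e ltnn.
Qed.

(** * Forests that choose a path in each blade of a windmill *)

Section Windmill.
Variables (H : graph) (Y : Type) (h : H) (p : option Y -> 'I_3 -> H).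
Hypotheses (ph : forall x, p x ord0 = h) (pT : triangle_family p).
Variable c : Y -> 'I_3.

(** [W] takes from each blade the two edges at the centre [ctr x]. The centre is free in the blades
    [Some y]; the blade [None] is kept aside to make three forests out of each choice. *)
Let ctr (x : option Y) := if x is Some y then c y else ord0.
Let W u v := exists x j, j <> ctr x /\ edge_rel (p x (ctr x)) (p x j) u v.
(** The hub has rank 0, a centre other than the hub rank 1, all else rank 2. Thus a vertex has at
    most one [W]-neighbour of lower rank: the hub or the centre of its blade. [lvl] computes the
    rank within a blade. *)
Let lvl x i := if i == ord0 then 0 else if i == ctr x then 1 else 2.
Let rank v := if `[< v = h >] then 0 else
  if `[< exists x, v = p x (ctr x) >] then 1 else 2.

Let rankE x i : rank (p x i) = lvl x i.
Proof.
have pI := @triangle_family_inj _ _ _ _ pT; have [_ pD] := pT.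
rewrite /rank /lvl; case: asboolP => [|nh].
  by rewrite -(ph x) => /pI ->; rewrite eqxx.
have i0 : i != ord0 by apply/eqP => i0; apply: nh; rewrite i0 ph.
rewrite (negbTE i0); case: asboolP => [[x' e]|nex].
  case: (pD _ _ _ _ e) => [ex|/eqP]; last by rewrite (negbTE i0).
  by move: e; rewrite -ex => /pI ->; rewrite eqxx.
by case: eqP => // ei; case: nex; exists x; rewrite -ei.
Qed.

Let W_sym : sym W.
Proof. by move=> u v [x [j [nj r]]]; exists x, j; split=> //; apply: edge_relC. Qed.

Let W_adj u v : W u v -> adj u v.
Proof.
move=> [x [j [nj r]]]; apply: edge_rel_sym (@adj_sym H) r _.
by apply: (proj1 pT); apply: nesym.
Qed.

Let W_down u v : W u v -> rank v < rank u ->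
  exists x i, [/\ u = p x i, i <> ord0 & v = p x (if i == ctr x then ord0 else ctr x)].
Proof.
move=> [x [j [nj [[-> ->]|[-> ->]]]]]; rewrite !rankE /lvl.
  case: (ctr x =P ord0) => [_|n0]; first by rewrite ltn0.
  rewrite eqxx; case: (j =P ord0) => [j0 _|_]; last by case: ifP.
  by exists x, (ctr x); rewrite eqxx j0.
move=> lt; have j0 : j <> ord0 by move=> j0; move: lt; rewrite j0.
by exists x, j; split=> //; case: (j =P ctr x).
Qed.

Let W_bridged : bridged W.
Proof.
apply: (@rank_bridged _ _ rank) W_sym _ _.
  move=> u v [x [j [nj r]]] e.
  have : lvl x (ctr x) = lvl x j.
    by rewrite -!rankE; case: r e => [[-> ->]|[-> ->]].
  rewrite /lvl; case: (ctr x =P ord0) => [e0|n0].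
    by case: (j =P ord0) => [j0|_]; [rewrite e0 j0 in nj | case: ifP].
  by rewrite eqxx; case: ifP => // _; case: (j =P ctr x).
move=> u v w Wv Ww /(W_down Wv) [x [i [ux i0 ->]]] /(W_down Ww) [x' [i' [ux' i'0 ->]]].
have e : p x i = p x' i' by rewrite -ux -ux'.
have [_ pD] := pT; have [xx|//] := pD _ _ _ _ e.
by move: e; rewrite -xx => /(triangle_family_inj pT) ->.
Qed.

(** A maximal forest containing [W] misses the third edge of every blade. In the blade [None],
    exchanging [h A] or [h B] for the missed edge [A B] gives two more forests, without affecting
    the other blades. *)
Lemma windmill_forests :
  exists q : 'I_3 -> forest_graph H,
    (forall k l, k <> l -> adj (q k) (q l)) /\
    (forall k y i j, i <> j ->
      (edges (q k) (p (Some y) i) (p (Some y) j) <-> c y = i \/ c y = j)).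
Proof.
have pI x := @triangle_family_inj _ _ _ x pT; have [pA pD] := pT.
have [t tW] := extend_forest W_sym W_adj W_bridged.
have [sR aR bR cR] := edges_spanning t.
have tin x j : j <> ctr x -> edges t (p x (ctr x)) (p x j).
  by move=> nj; apply: tW; exists x, j; split=> //; apply: edge_rel_refl.
have tout x i j : i <> j -> i <> ctr x -> j <> ctr x -> ~ edges t (p x i) (p x j).
  move=> ij ic jc tij.
  apply: (@bridged_triangle _ _ (p x i) (p x j) (p x (ctr x)) bR) => //;
    first [exact/adj_neq/pA | exact: tin | exact/sR/tin].
have tP x i j : i <> j -> (edges t (p x i) (p x j) <-> ctr x = i \/ ctr x = j).
  move=> ij; split=> [tij|[e|e]]; last 2 first.
  - by rewrite -e; apply: tin; rewrite e; apply: nesym.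
  - by rewrite -e; apply/sR/tin; rewrite e.
  apply: contrapT => /not_orP [ni nj].
  by apply: (tout x i j) => //; apply: nesym.
pose A := p None ord31; pose B := p None ord32.
have AB : adj A B by apply: pA.
have nAB : ~ edges t A B by apply: tout.
have thA : edges t h A by rewrite -(ph None); apply/tP => //; left.
have thB : edges t h B by rewrite -(ph None); apply/tP => //; left.
have hA : h <> A by rewrite -(ph None) => /pI.
have hB : h <> B by rewrite -(ph None) => /pI.
have AneqB : A <> B by move=> /pI.
have nhAhB : ~ edge_rel h A h B by case=> [[_ /esym]|[]].
have cutA : ~ conn (del (edges t) h A) A B.
  move=> con; apply: (bR _ _ thA).
  apply: (@conn_step _ _ _ B); first by split.
  exact: (conn_sym (del_sym sR)).
have cutB : ~ conn (del (edges t) h B) A B.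
  move=> con; apply: (bR _ _ thB).
  apply: (@conn_step _ _ _ A); last exact: con.
  by split=> // -[[_]|[]].
have [t1 E1 A1] := exchange thA AB nAB cutA.
have [t2 E2 A2] := exchange thB AB nAB cutB.
exists (tri3 t t1 t2); split.
  by apply: tri3_adj => //; apply: swap_adj thA thB nhAhB nAB E1 E2.
move=> k y i j ij; rewrite -(tP (Some y)) //.
(* Two blades share only the hub, so no edge of the blade [None] lies in the blade [Some y]. *)
have noN i' j' : i' <> j' ->
    ~ edge_rel (p None i') (p None j') (p (Some y) i) (p (Some y) j).
  by move=> _ [] [/pD [//|i0] /pD [//|j0]]; case: ij; rewrite i0 j0.
have swapE a b : ~ edge_rel a b (p (Some y) i) (p (Some y) j) ->
    (swap (edges t) a b A B (p (Some y) i) (p (Some y) j) <->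
     edges t (p (Some y) i) (p (Some y) j)).
  by move=> nab; split=> [[[]//|/noN []]|?] //; left; split.
case: (ord3P k) => ->; rewrite /tri3 /= ?(E1, E2) //; apply: swapE;
  by rewrite -(ph None); apply: noN.
Qed.

End Windmill.

Lemma windmill_step (H : graph) Y (h : H) (p : option Y -> 'I_3 -> H) :
  (forall x, p x ord0 = h) -> triangle_family p ->
  nullity_ge (forest_graph H) (Y -> 'I_3).
Proof.
move=> ph pT; have /choice [q qP] := windmill_forests ph pT.
apply: (@triangles_nullity _ _ q); split=> [c|c c' k k' e].
  by have [] := qP c.
left; apply/funext => y; apply: contrapT => cc.
(* The edge between indices [c y] and [j] belongs to every forest built from [c] and to none built
   from [c']; so distinct choices give vertex-disjoint triangles. *)
have [j [cj c'j]] := ord3_third (c y) (c' y).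
have [_ E] := qP c; have [_ E'] := qP c'.
have := iffRL (E k y _ _ cj) (or_introl erefl).
by rewrite e => /(E' k' y _ _ cj) [/esym|].
Qed.

Lemma nullity_forest (G : graph) X : nullity_ge G X -> nullity_ge (forest_graph G) X.
Proof. by case/nullity_windmill=> t [p [_ /triangles_nullity]]. Qed.

Lemma nullity_step (G : graph) Y :
  nullity_ge G (option Y) -> nullity_ge (forest_graph (forest_graph G)) (Y -> 'I_3).
Proof. by case/nullity_windmill=> t [p [pt pT]]; apply: windmill_step pt pT. Qed.

(** * Periodic graphs *)

Definition embeds (X Z : Type) := exists f : X -> Z, injective f.

Lemma embeds_trans X Y Z : embeds X Y -> embeds Y Z -> embeds X Z.
Proof. by move=> [f fI] [g gI]; exists (g \o f); apply: inj_comp. Qed.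

Lemma embeds_prod X Y X' Y' : embeds X X' -> embeds Y Y' -> embeds (X * Y) (X' * Y').
Proof.
move=> [f fI] [g gI]; exists (fun z => (f z.1, g z.2)).
by move=> [a b] [c d] [/fI -> /gI ->].
Qed.

Lemma cantor Z : ~ embeds (Z -> Prop) Z.
Proof.
move=> [f fI]; pose D z := exists2 S, f S = z & ~ S z.
have DfD : ~ D (f D) by move=> [S /fI -> nD]; apply: (nD); exists D.
by apply: (DfD); exists D.
Qed.

Definition pow n (Y : Type) : Type := iter n (fun Z : Type => Z -> Prop) Y.

Lemma embeds_pow n Y : embeds Y (pow n Y).
Proof.
elim: n => [|n IH]; first by exists id.
(* Elements are sent to singletons. *)
apply: embeds_trans IH _; exists (fun z z' => z' = z) => z z' e.
by have <- : (z = z) = (z = z') by exact: (congr1 (@^~ z) e).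
Qed.

Lemma embeds_option X : embeds (option X) (X -> Prop).
Proof.
exists (fun o x => o = Some x).
have E (x : X) : Some x <> None by [].
move=> [x|] [y|] // e.
- by rewrite -[LHS]/(Some x) (_ : (Some y = Some x)) // -(congr1 (@^~ x) e).
- by have : (None = Some x) by rewrite -(congr1 (@^~ x) e).
- by have : (None = Some y) by rewrite (congr1 (@^~ y) e).
Qed.

(** This is the Kuratowski pair: [f] codes [(a, b)] as the set of the two sets {a} and {a, b}. It
    serves finite and infinite [X] alike. *)
Lemma embeds_square X : embeds (X * X) (pow 2 X).
Proof.
pose sg (a b : X) (x : X) := x = a \/ x = b.
have sgI a b a' b' : sg a b = sg a' b' -> (a = a' \/ a = b') /\ (b = a' \/ b = b').
  by move=> e; split; [have: sg a b a by left | have: sg a b b by right]; rewrite e.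
pose f (z : X * X) (S : X -> Prop) := S = sg z.1 z.1 \/ S = sg z.1 z.2.
exists f => -[a b] [a' b'] e.
have fI : (sg a a = sg a' a' \/ sg a a = sg a' b') /\
          (sg a b = sg a' a' \/ sg a b = sg a' b').
  split; [have: f (a, b) (sg a a) by left | have: f (a, b) (sg a b) by right];
    by rewrite e.
have fI' : sg a' b' = sg a a \/ sg a' b' = sg a b.
  by rewrite -[_ \/ _]/(f (a, b) (sg a' b')) e; right.
have {e}aa : a = a'.
  case: fI => [[/sgI|/esym/sgI] H _]; first by case: H => [[]].
  by case: H => [[]].
subst a'; congr (_, _).
case: fI => _ [/sgI [_ ba]|/sgI [_ [ba|//]]].
  have {}ba : b = a by case: ba.
  by subst b; case: fI' => /sgI [_ []].
by subst b; case: fI' => /sgI [_ []].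
Qed.

Lemma embeds_ord3 Y : inhabited Y -> embeds 'I_3 (pow 2 Y).
Proof.
move=> [y]; apply: embeds_trans (embeds_option (Y -> Prop)).
exists (tri3 None (Some (fun=> True)) (Some (fun=> False))).
have TF : (fun _ : Y => True) <> (fun=> False).
  by move=> /(congr1 (@^~ y)) e; rewrite -[False]e.
move=> i j; case: (ord3P i) => ->; case: (ord3P j) => ->; rewrite /tri3 //=.
  by move=> [/TF].
by move=> [/esym /TF].
Qed.

Lemma pow_inhabited n Y : inhabited Y -> inhabited (pow n Y).
Proof. by case: n => // n _; apply: (inhabits (fun=> True)). Qed.

(** * Invariance under isomorphism *)

Section Transport.
Variables (G H : graph) (f : G -> H) (g : H -> G).
Hypotheses (fK : cancel f g) (gK : cancel g f).
Hypothesis fadj : forall x y, adj x y <-> adj (f x) (f y).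

Lemma conn_map V W (h : V -> W) (R : V -> V -> Prop) (R' : W -> W -> Prop) x y :
  (forall u v, R u v -> R' (h u) (h v)) -> conn R x y -> conn R' (h x) (h y).
Proof.
move=> hR; elim=> [z|{}x z {}y /hR Rxz _]; first exact: conn_refl.
exact: conn_step.
Qed.

Lemma edge_rel_map V W (h : V -> W) a b x y :
  edge_rel a b x y -> edge_rel (h a) (h b) (h x) (h y).
Proof. by move=> [[-> ->]|[-> ->]]; [left|right]. Qed.

Lemma transport : exists F : forest_graph G -> forest_graph H,
  (forall t u v, edges (F t) u v = edges t (g u) (g v)) /\
  (forall t t', adj t t' -> adj (F t) (F t')).
Proof.
have gadj u v : adj u v <-> adj (g u) (g v) by rewrite fadj !gK.
have gI := can_inj gK.
have /choice [F FE] (t : forest_graph G) : exists t' : forest_graph H,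
    edges t' = fun u v => edges t (g u) (g v).
  have [sR aR bR cR] := edges_spanning t; apply: spanning_edges; split.
  - by move=> u v /sR.
  - by move=> u v /aR /gadj.
  - move=> u v /bR nc con; apply: nc; apply: conn_map con => p q [? npq].
    split=> // /(edge_rel_map f); rewrite !gK; exact: npq.
  - move=> u v /gadj /cR con; rewrite -[u]gK -[v]gK.
    by apply: conn_map con => p q; rewrite !fK.
exists F; split=> [t u v|t t' /forest_adjP [a [b [c [d [tab cd ncd E]]]]]].
  by rewrite FE.
apply/forest_adjP; exists (f a), (f b), (f c), (f d); rewrite !FE !fK; split=> //.
  exact/fadj.
have ge p q u v : edge_rel p q (g u) (g v) <-> edge_rel (f p) (f q) u v.
  split=> [/(edge_rel_map f)|/(edge_rel_map g)]; by rewrite ?fK ?gK.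
move=> u v; rewrite E /swap /add /del; split.
  by move=> [[? n]|/ge]; [left; split=> // /ge | right].
by move=> [[? n]|/ge]; [left; split=> // /ge | right].
Qed.

End Transport.

Lemma isomorphic_refl (G : graph) : isomorphic G G.
Proof. by exists id; split=> //; exists id. Qed.

Lemma isomorphic_sym (G H : graph) : isomorphic G H -> isomorphic H G.
Proof.
move=> [f [[g fK gK] fadj]]; exists g; split; first by exists f.
by move=> x y; rewrite fadj !gK.
Qed.

Lemma isomorphic_trans (G H K : graph) :
  isomorphic G H -> isomorphic H K -> isomorphic G K.
Proof.
move=> [f [fB fadj]] [g [gB gadj]]; exists (g \o f); split; first exact: bij_comp.
by move=> x y; rewrite fadj gadj.
Qed.

Lemma forest_graph_iso (G H : graph) :
  isomorphic G H -> isomorphic (forest_graph G) (forest_graph H).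
Proof.
move=> [f [[g fK gK] fadj]].
have gadj u v : adj u v <-> adj (g u) (g v) by rewrite fadj !gK.
have [F [FE FA]] := transport fK gK fadj.
have [F' [FE' FA']] := transport gK fK gadj.
have FK : cancel F F' by move=> t; apply: edges_inj => x y; rewrite FE' FE !fK.
have F'K : cancel F' F by move=> t; apply: edges_inj => x y; rewrite FE FE' !gK.
exists F; split; first by exists F'.
by move=> t t'; split=> [/FA //|/FA']; rewrite !FK.
Qed.

Lemma iter_forest_graph_iso n (G H : graph) : isomorphic G H ->
  isomorphic (iter_forest_graph n G) (iter_forest_graph n H).
Proof. by move=> GH; elim: n => // n; apply: forest_graph_iso. Qed.

Lemma iter_period (G : graph) p n : isomorphic G (iter_forest_graph p G) ->
  isomorphic G (iter_forest_graph (n * p) G).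
Proof.
move=> Gp; elim: n => [|n IH]; first exact: isomorphic_refl.
rewrite mulSn /iter_forest_graph iterD; apply: isomorphic_trans Gp _.
exact: (@iter_forest_graph_iso p).
Qed.

Lemma nullity_iso (G H : graph) X :
  isomorphic G H -> nullity_ge G X -> nullity_ge H X.
Proof.
move=> [f [[g fK gK] fadj]] [t [a [b [ab dist]]]].
have [F [FE _]] := transport fK gK fadj.
exists (F t), (f \o a), (f \o b); split=> [x|x x' r]; last first.
  by apply: dist; have := edge_rel_map g r; rewrite /= !fK.
by rewrite FE /= !fK; have [/fadj] := ab x.
Qed.

Lemma nullity_sub (G : graph) X Z : embeds Z X -> nullity_ge G X -> nullity_ge G Z.
Proof.
move=> [i iI] [t [a [b [ab dist]]]]; exists t, (a \o i), (b \o i).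
by split=> [x|x x' /dist /iI //]; apply: ab.
Qed.

Lemma nullity_embeds (G : graph) X : nullity_ge G X -> embeds X (G * G).
Proof.
move=> [t [a [b [_ dist]]]]; exists (fun x => (a x, b x)) => x x' [ax bx].
by apply: dist; rewrite ax bx; apply: edge_rel_refl.
Qed.

(** Two iterations yield a power set: a subset is coded by the values [ord0] and [ord31], and the
    constant function [ord32] supplies the additional element needed for the next round. *)
Lemma nullity_pow (G : graph) Y n : inhabited Y -> nullity_ge G (option Y) ->
  nullity_ge (iter_forest_graph n.*2 G) (option (pow n Y)).
Proof.
move=> iY GY; elim: n => [//|n /nullity_step]; apply: nullity_sub.
have [z] := pow_inhabited n iY.
exists (fun o => if o is Some A then
    fun z => if `[< A z >] then ord0 else ord31 else fun=> ord32).
move=> [A|] [A'|] // e; last 2 first.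
- by have := congr1 (@^~ z) e; rewrite /=; case: ifP.
- by have := congr1 (@^~ z) e; rewrite /=; case: ifP.
congr Some; apply/predeqP => z'; have := congr1 (@^~ z') e.
by rewrite /=; case: asboolP => ?; case: asboolP.
Qed.

(* A vertex of a triangle either lies on an edge outside of the maximal forest
   [t], or is the only [t]-neighbour of both ends of such an edge. *)
Lemma vertices_code (G : graph) (t : forest_graph G) X (a b : X -> G) :
  (forall v : G, exists p : 'I_3 -> G,
     p ord0 = v /\ forall i j, i <> j -> adj (p i) (p j)) ->
  (forall x, adj (a x) (b x) /\ ~ edges t (a x) (b x)) ->
  (forall u v, adj u v -> ~ edges t u v -> exists x, edge_rel (a x) (b x) u v) ->
  embeds G (X * 'I_3).
Proof.
move=> tri ab abE; have [sR aR bR cR] := edges_spanning t.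
(* The tag [k] tells whether [v] is the first end of the missed edge, its second end, or a common
   [t]-neighbour of both. *)
pose code v x (k : 'I_3) := [\/ k = ord0 /\ v = a x, k = ord31 /\ v = b x
  | k = ord32 /\ (edges t v (a x) /\ edges t v (b x))].
have codeP v : exists xk : X * 'I_3, code v xk.1 xk.2.
  have [p [p0 pA]] := tri v.
  have endP w : adj v w -> ~ edges t v w -> exists xk : X * 'I_3, code v xk.1 xk.2.
    move=> vw nvw; have [x [[e _]|[e _]]] := abE _ _ vw nvw.
      by exists (x, ord0); constructor 1.
    by exists (x, ord31); constructor 2.
  have v1 : adj v (p ord31) by rewrite -p0; apply: pA.
  have v2 : adj v (p ord32) by rewrite -p0; apply: pA.
  have p12 : adj (p ord31) (p ord32) by apply: pA.
  case: (pselect (edges t v (p ord31))) => [t1|]; last exact: endP.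
  case: (pselect (edges t v (p ord32))) => [t2|]; last exact: endP.
  have n12 : ~ edges t (p ord31) (p ord32).
    move=> t12; by apply: (bridged_triangle bR _ _ _ t1 t2 (sR _ _ t12)); apply/adj_neq.
  have [x [[e1 e2]|[e1 e2]]] := abE _ _ p12 n12;
    by exists (x, ord32); constructor 3; rewrite -e1 -e2.
have [f fP] := choice codeP; exists f => v v' e.
have := fP v; have := fP v'; rewrite -e; case: (f v) => x k /=.
have [xab nxab] := ab x; have nab := adj_neq xab.
case=> -[-> H] [[ek H']|[ek H']|[ek H']] //; rewrite ?H ?H' //.
case: H H' => v'a v'b [va vb]; apply: contrapT => vv'.
have neq u w : edges t u w -> u <> w by move=> /aR /adj_neq.
(* Two common [t]-neighbours [v] and [v'] of [a x] and [b x] would form a cycle of length 4 in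
   [t]. *)
apply: (bR _ _ va); apply: (@conn_step _ _ _ (b x)).
  by split=> // -[[_ /esym]|[/(neq _ _ va)]].
apply: (@conn_step _ _ _ v').
  split; first exact: sR.
  by case=> [[e1 _]|[e1 _]]; [case: (neq _ _ vb) | case: nab].
apply: conn1; split=> // -[[/esym //]|[e1 _]]; exact: neq v'a e1.
Qed.

Lemma not_periodic (H : graph) p :
  (forall v : H, exists p : 'I_3 -> H,
     p ord0 = v /\ forall i j, i <> j -> adj (p i) (p j)) ->
  nullity_ge H bool -> 0 < p -> ~ isomorphic H (iter_forest_graph p H).
Proof.
move=> tri [t [a0 [b0 [ab0 dist0]]]] p_gt0 per.
(* Unordered edges are represented by their relations, so that [X] contains each edge missed by [t]
   exactly once. *)
pose N (E : H -> H -> Prop) :=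
  exists e : H * H, (adj e.1 e.2 /\ ~ edges t e.1 e.2) /\ E = edge_rel e.1 e.2.
pose X := {E | N E}.
have /choice [e eP] (x : X) : exists e : H * H,
    (adj e.1 e.2 /\ ~ edges t e.1 e.2) /\ proj1_sig x = edge_rel e.1 e.2.
  exact: (proj2_sig x).
pose a x := (e x).1; pose b x := (e x).2.
have ab x : adj (a x) (b x) /\ ~ edges t (a x) (b x) by have [] := eP x.
have edgeE (u v u' v' : H) : edge_rel u v u' v' -> edge_rel u v = edge_rel u' v'.
  move=> r; apply/predeq2P => w z; split=> h; last first.
    by case: r h => [[-> ->]|[-> ->]] //; apply: edge_rel_swap.
  by case: r => [[-> ->]|[-> ->]] //; apply: edge_rel_swap.
have dist x x' : edge_rel (a x) (b x) (a x') (b x') -> x = x'.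
  move=> /edgeE r; have [_ E] := eP x; have [_ E'] := eP x'.
  by case: x x' r E E' => [? ?] [? ?] r /= E E'; apply: eq_exist; rewrite E E'.
have abE u v : adj u v -> ~ edges t u v -> exists x, edge_rel (a x) (b x) u v.
  move=> uv nuv; have Nuv : N (edge_rel u v) by exists (u, v).
  exists (exist _ _ Nuv); have [_ /= E] := eP (exist _ _ Nuv).
  by rewrite /a /b -E; apply: edge_rel_refl.
have nullX : nullity_ge H X by exists t, a, b.
have [xt xtE] := abE _ _ (proj1 (ab0 true)) (proj2 (ab0 true)).
have [xf xfE] := abE _ _ (proj1 (ab0 false)) (proj2 (ab0 false)).
have tf : xf <> xt.
  move=> fE; rewrite fE in xfE.
  by have := dist0 true false; rewrite -(edgeE _ _ _ _ xtE) => /(_ xfE).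
(* Setting one missed edge aside makes [X] equivalent to [option Y]; a second missed edge shows that
   [Y] is inhabited. *)
pose Y := {x | x <> xt}.
have iY : inhabited Y by apply: inhabits; exists xf.
have YX : embeds (option Y) X.
  exists (fun o => if o is Some y then proj1_sig y else xt).
  move=> [[y ny]|] [[y' ny']|] //= E; first by congr Some; apply: eq_exist.
  by case: ny'.
have XY : embeds X (option Y).
  exists (fun x => if pselect (x = xt) is right n then Some (exist _ x n) else None).
  move=> x x' /=; case: pselect => [->|n]; case: pselect => [->|n'] //.
  by move=> [].
(* After [14 * p] iterations, a multiple of the period, the graph is [H] again. As [H] embeds into
   [pow 4 Y] and [H * H] into [pow 6 Y], the [7 * p] power sets gained, at least 7, contradict
   Cantor's theorem. *)
have big := nullity_pow (7 * p) iY (nullity_sub YX nullX).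
rewrite -mul2n mulnA in big.
have {}big := nullity_iso (isomorphic_sym (iter_period (2 * 7) per)) big.
have {}big := nullity_embeds big.
apply: (@cantor (pow 6 Y)).
apply: (@embeds_trans _ (pow (7 * p) Y)).
  have -> : 7 * p = 7 * p.-1 + 7 by rewrite -{1}(prednK p_gt0) mulnS addnC.
  by rewrite {2}/pow iterD; apply: embeds_pow.
apply: (@embeds_trans _ (option (pow (7 * p) Y))); first by exists Some => ? ? [].
apply: embeds_trans big _.
suff V4 : embeds H (pow 4 Y).
  exact: embeds_trans (embeds_prod V4 V4) (embeds_square _).
apply: embeds_trans (vertices_code tri ab abE) _.
have X2 : embeds X (pow 2 Y).
  apply: embeds_trans XY (embeds_trans (embeds_option _) _).
  exact: (@embeds_pow 1).
exact: embeds_trans (embeds_prod X2 (embeds_ord3 iY)) (embeds_square _).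
Qed.

(** * Convergence *)

Lemma nullity_bool (G : graph) (t : forest_graph G) a b c d :
  adj a b -> ~ edges t a b -> adj c d -> ~ edges t c d -> ~ edge_rel a b c d ->
  nullity_ge G bool.
Proof.
move=> ab nab cd ncd n; exists t, (fun x : bool => if x then a else c),
  (fun x : bool => if x then b else d).
split=> [[]|[] [] // r] //; case: n;
  first [exact: r | exact: edge_rel_flip r].
Qed.

(** A maximal forest misses an edge [x y] of the triangle [a b c]; in the triangle of the three
    vertices other than [y] it misses another edge. *)
Lemma K4_nullity (G : graph) (a b c d : G) :
  adj a b -> adj a c -> adj a d -> adj b c -> adj b d -> adj c d ->
  nullity_ge G bool.
Proof.
have [t] := forest_graph_inhabited G.
have {}H (x y z w : G) : adj x y -> adj x z -> adj x w -> adj y z -> adj y w ->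
    adj z w -> ~ edges t x y -> nullity_ge G bool.
  move=> xy xz xw yz yw zw nxy.
  have tA := tri3_adj xz xw zw.
  have [i [j [ij nij]]] := triangle_missing t tA.
  apply: (nullity_bool xy nxy (tA _ _ ij) nij).
  have ny k : tri3 x z w k <> y.
    case: (ord3P k) => ->; rewrite /tri3 /=; [|apply: nesym|apply: nesym];
      exact/adj_neq.
  by case=> -[]; [move=> _ /ny | move=> /ny].
have sG := @adj_sym G.
move=> ab ac ad bc bd cd.
have [i [j [ij]]] := triangle_missing t (tri3_adj ab ac bc).
case: (ord3P i) ij => ->; case: (ord3P j) => -> // _; rewrite /tri3 /=.
- exact: (H a b c d).
- by apply: (H a c b d) => //; apply: sG.
- by apply: (H b a c d) => //; apply: sG.
- by apply: (H b c a d) => //; apply: sG.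
- by apply: (H c a b d) => //; apply: sG.
- by apply: (H c b a d) => //; apply: sG.
Qed.

(** * Cycles that force divergence *)

Lemma cycle_missing (G : graph) (C : subgraph G) (t : forest_graph G) :
  is_cycle C -> exists x y, sub_edge C x y /\ ~ edges t x y.
Proof.
move=> cC; apply: contrapT => nex.
have [allt _] := iffLR (maximal_forestP _) (proj2_sig t).
have [ft _] := proj2_sig t; apply: (ft C) => //; split=> // x y Cxy.
by apply: contrapT => nt; apply: nex; exists x, y.
Qed.

(** The right-hand side does not mention [C]: a cycle with a single edge outside [t] is determined
    by [t] and that edge. *)
Lemma cycle_fundamental (G : graph) (C : subgraph G) (t : forest_graph G) x y :
  is_cycle C -> sub_edge C x y -> ~ edges t x y ->
  (forall u v, sub_edge C u v -> ~ edge_rel x y u v -> edges t u v) ->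
  forall u v, sub_edge C u v <->
    edge_rel x y u v \/ edges t u v /\ ~ conn (del (edges t) u v) x y.
Proof.
move=> cC Cxy nxy Ct u v; have [sR aR bR cR] := edges_spanning t.
have con := cycle_connect cC Cxy.
have sC : sym (sub_edge C) := @sub_edge_sym _ C.
have sDt := del_sym (a := u) (b := v) sR.
split=> [Cuv|[r|[tuv cut]]].
- case: (pselect (edge_rel x y u v)) => [?|n]; first by left.
  right; split; first exact: Ct.
  move=> cont; apply: (bR _ _ (Ct _ _ Cuv n)).
  have CD p q : conn (del (del (sub_edge C) x y) u v) p q ->
      conn (del (edges t) u v) p q.
    by apply: conn_sub => p' q' [[Cpq npq] n']; split=> //; apply: Ct.
  (* Along the rest of [C], the vertices [x] and [y] reach different ends of [u v]; a connection of
     [x] with [y] avoiding [u v] would thus bypass it. *)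
  case: (conn_del u v (del_sym sC) con) => [/(cycle_disconnect cC Cxy Cuv n) //||].
    move=> [/CD xu /CD vy]; apply: conn_trans (conn_sym sDt xu) _.
    exact: conn_trans cont (conn_sym sDt vy).
  move=> [/CD xv /CD uy]; apply: conn_trans uy _.
  exact: conn_trans (conn_sym sDt cont) xv.
- exact: edge_rel_sym sC r Cxy.
apply: contrapT => nCuv; apply: cut.
apply: conn_sub con => p q [Cpq npq]; split; first exact: Ct.
by move=> r; apply: nCuv; apply: edge_rel_sym sC (edge_rel_flip r) Cpq.
Qed.

Lemma cycle_vert (G : graph) (C : subgraph G) x :
  is_cycle C -> (sub_vert C x <-> exists y, sub_edge C x y).
Proof.
move=> [n [_ [c [_ cV cE]]]]; split=> [/cV [i ->]|[y /sub_edge_vert []] //].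
by exists (c (ordS i)); apply/cE; exists i; apply: edge_rel_refl.
Qed.

(** If [t] missed just one edge, both cycles would be the fundamental cycle of that edge. *)
Lemma two_cycles_nullity (G : graph) (C C' : subgraph G) :
  is_cycle C -> is_cycle C' -> C <> C' -> nullity_ge G bool.
Proof.
move=> cC cC' CC'.
have [t] := forest_graph_inhabited G.
apply: contrapT => n2.
have [x [y [Cxy nxy]]] := cycle_missing t cC.
have outE u v : adj u v -> ~ edges t u v -> edge_rel x y u v.
  move=> uv nuv; apply: contrapT => n; apply: n2.
  exact: nullity_bool (sub_edge_adj Cxy) nxy uv nuv n.
have inE (D : subgraph G) u v : sub_edge D u v -> ~ edge_rel x y u v -> edges t u v.
  by move=> /sub_edge_adj uv n; apply: contrapT => /(outE _ _ uv).
have C'xy : sub_edge C' x y.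
  have [x' [y' [C'xy' nxy']]] := cycle_missing t cC'.
  apply: (edge_rel_sym (@sub_edge_sym _ C') _ C'xy').
  by apply: edge_rel_flip; apply: outE nxy'; apply: sub_edge_adj C'xy'.
have EE u v : sub_edge C u v <-> sub_edge C' u v.
  have H := cycle_fundamental cC Cxy nxy (@inE C) u v.
  have H' := cycle_fundamental cC' C'xy nxy (@inE C') u v.
  by split=> [/H /H'|/H' /H].
apply: CC'; apply: subgraph_ext => // z.
split=> [/(cycle_vert _ cC) [w /EE zw]|/(cycle_vert _ cC') [w /EE zw]].
  by apply/(cycle_vert _ cC'); exists w.
by apply/(cycle_vert _ cC); exists w.
Qed.

(** If no forest misses two edges, the cycle consists of the one missed edge and at least three
    edges of [t]. Exchanging each of three of them for the missed edge gives three forests that form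
    a [K4] with [t]. *)
Lemma long_cycle_nullity (G : graph) (C : subgraph G) n :
  cycle_of_length n C -> 3 < n -> nullity_ge (forest_graph G) bool.
Proof.
case: n => // n Cn n3.
case: (pselect (nullity_ge G bool)) => [/nullity_forest //|n2].
have [t] := forest_graph_inhabited G.
have cC : is_cycle C by exists n.+1.
have [x [y [Cxy nxy]]] := cycle_missing t cC.
have [g [ginj xy CE]] := cycle_rotate Cn Cxy.
have [sR aR bR cR] := edges_spanning t.
have l2 : 2 < n by [].
have n1 := ltnW l2; have l0 := ltnW n1.
have gS k : k < n -> edges t (g k) (g k.+1).
  move=> kn; apply: contrapT => nk; apply: n2.
  apply: nullity_bool (sub_edge_adj Cxy) nxy _ nk _.
    by apply: (@sub_edge_adj _ C); apply/CE; left; exists k => //; apply: edge_rel_refl.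
  move=> r; apply: (closing_edge n1 ginj kn).
  by case: xy r => [[-> ->]|[-> ->]] // r; apply: edge_rel_swap.
have cd : adj (g 0) (g n).
  by apply: (edge_rel_sym (@adj_sym G) _ (sub_edge_adj Cxy));
     case: xy => [[-> ->]|[-> ->]]; [right | left].
have ncd : ~ edges t (g 0) (g n).
  by move=> H; apply: nxy; case: xy => [[-> ->]|[-> ->]] //; apply: sR.
have cut k (kn : k < n) := path_cut sR bR ginj gS kn.
have [t0 E0 A0] := exchange (gS _ l0) cd ncd (cut _ l0).
have [t1 E1 A1] := exchange (gS _ n1) cd ncd (cut _ n1).
have [t2 E2 A2] := exchange (gS _ l2) cd ncd (cut _ l2).
apply: (K4_nullity A0 A1 A2).
- by apply: swap_adj ncd E0 E1; try exact: gS; move=> /(path_edge_inj ginj l0 n1).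
- by apply: swap_adj ncd E0 E2; try exact: gS; move=> /(path_edge_inj ginj l0 l2).
- by apply: swap_adj ncd E1 E2; try exact: gS; move=> /(path_edge_inj ginj n1 l2).
Qed.

Lemma nullity_iter n (G : graph) X :
  nullity_ge G X -> nullity_ge (iter_forest_graph n G) X.
Proof. by move=> GX; elim: n => // n; apply: nullity_forest. Qed.

Lemma divergent (G : graph) :
  nullity_ge (forest_graph G) bool -> ~ F_convergent G.
Proof.
move=> G2 [k [H HP]].
have nul n : nullity_ge (iter_forest_graph n.+1 G) bool.
  by rewrite /iter_forest_graph iterSr; apply: nullity_iter.
(* The shift by 3 puts every vertex in a triangle: the iterate [m + 1] has two missed edges, so
   [m + 2] contains a triangle; each of its maximal forests misses an edge of it, hence lies in a
   triangle of [m + 3]. *)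
have /choice [f fP] (n : 'I_k.+1) := HP (n + 3).
(* Among [k.+1] iterates, two have the same representative. *)
have [m [m' [mm' e]]] : exists m m' : 'I_k.+1, m < m' /\ f m = f m'.
  have : ~ injective f.
    by move=> /leq_card; rewrite !card_ord ltnn.
  move=> ninj; apply: contrapT => nex; apply: ninj => m m' e.
  apply: val_inj; case: (ltngtP m m') => // lt; case: nex.
    by exists m, m'.
  by exists m', m.
pose K := iter_forest_graph (m + 3) G.
have mmE : m' + 3 = (m' - m) + (m + 3) by rewrite addnA subnK // ltnW.
have per : isomorphic K (iter_forest_graph (m' - m) K).
  rewrite /K /iter_forest_graph -iterD -mmE.
  by apply: isomorphic_trans (fP m) _; rewrite e; apply/isomorphic_sym/fP.
apply: not_periodic per.
- rewrite /K addnS => t.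
  have [h [p [_ [pA _]]]] := nullity_windmill (nul m).
  have pA' := pA true.
  rewrite addnS addn1 in t *.
  have [i [j [ij nij]]] := triangle_missing t pA'.
  by have [q [q0 qA _ _]] := forest_triangle (pA' _ _ ij) nij; exists q.
- by rewrite /K addnS; apply: nul.
- by rewrite subn_gt0.
Qed.

Lemma bijective_surj A B (f : A -> B) :
  injective f -> (forall y, exists x, f x = y) -> bijective f.
Proof.
move=> fI /choice [g gK]; exists g => // x; exact/fI/gK.
Qed.

(** * The convergent graphs *)

Definition K1 : graph := @Graph unit (fun _ _ => False) (fun _ _ H => H) (fun _ H => H).

Definition K3 : graph :=
  @Graph 'I_3 (fun x y => x <> y) (fun _ _ => nesym) (fun x H => H erefl).

Lemma acyclic_forest_graph (G : graph) : acyclic G -> isomorphic (forest_graph G) K1.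
Proof.
move=> aG; have sG := @adj_sym G.
have bG : bridged (@adj G).
  pose F := @Subgraph G (fun=> True) _ sG (fun _ _ H => H) (fun _ _ _ => conj I I).
  by apply: (iffLR (forest_bridged F)) => C _; apply: aG.
have [t tE] : exists t : forest_graph G, edges t = @adj G.
  by apply: spanning_edges; split=> // x y; apply: conn1.
have uniq t' : t' = t.
  have [sR aR bR cR] := edges_spanning t'.
  apply: edges_inj => x y; rewrite tE; split=> [/aR //|xy].
  apply: contrapT => nxy; apply: (bG _ _ xy); apply: conn_sub (cR _ _ xy) => u v tuv.
  split; first exact: aR.
  by move=> r; apply: nxy; apply: edge_rel_sym sR (edge_rel_flip r) tuv.
exists (fun=> tt); split; first by exists (fun=> t) => [t'|[]]; rewrite ?(uniq t').
by move=> x y; split=> //; rewrite (uniq x) (uniq y) => /adj_irrefl.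
Qed.

Lemma K1_acyclic : acyclic K1.
Proof.
move=> C [n [n2 [c [_ _ cE]]]]; case: n n2 c cE => // n _ c cE.
have /sub_edge_adj [] : sub_edge C (c ord0) (c (ordS ord0)).
by apply/cE; exists ord0; apply: edge_rel_refl.
Qed.

Definition unique_triangle (G : graph) := exists C : subgraph G,
  cycle_of_length 3 C /\ forall C' : subgraph G, is_cycle C' -> C' = C.

(** The index [k] corresponds to the forest [T k] of all edges but the [k]-th edge of the
    triangle. *)
Lemma triangle_forest_graph (G : graph) :
  unique_triangle G -> isomorphic K3 (forest_graph G).
Proof.
move=> [C [C3 uniqC]]; have cC : is_cycle C by exists 3.
have [_ [c [cI cV cE]]] := C3; have sG := @adj_sym G.
have Ce k : sub_edge C (c k) (c (ordS k)).
  by apply/cE; exists k; apply: edge_rel_refl.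
pose R k := del (@adj G) (c k) (c (ordS k)).
have sR k : sym (R k) by apply: del_sym.
have bR k : bridged (R k).
  pose F := @Subgraph G (fun=> True) _ (sR k) (fun _ _ H => proj1 H)
    (fun _ _ _ => conj I I).
  apply: (iffLR (forest_bridged F)) => D [_ DF] cD.
  have DC := uniqC _ cD; rewrite DC in DF.
  by have [_ []] := DF _ _ (Ce k); apply: edge_rel_refl.
have cR k x y : adj x y -> conn (R k) x y.
  move=> xy; case: (pselect (edge_rel (c k) (c (ordS k)) x y)) => [r|n]; last first.
    by apply: conn1.
  have con : conn (R k) (c k) (c (ordS k)).
    apply: conn_sub (cycle_connect cC (Ce k)) => u v [/sub_edge_adj uv n].
    by split.
  by case: r => [[-> ->]|[-> ->]] //; apply: (conn_sym (sR k)).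
have /choice [T TE] k : exists t : forest_graph G, edges t = R k.
  by apply: spanning_edges; split=> // [x y /proj1|]; last exact: cR.
have edge_inj k l : edge_rel (c k) (c (ordS k)) (c l) (c (ordS l)) -> k = l.
  move=> [[/cI //]|[/cI e1 /cI e2]]; move: e1 e2.
  by case: (ord3P k) => ->; case: (ord3P l) => -> // e1 e2;
    move: (congr1 val e1) (congr1 val e2).
have TI : injective T.
  move=> k l kl; apply: contrapT => n.
  have : R l (c k) (c (ordS k)).
    by split; [apply: sub_edge_adj (Ce k) | move=> /edge_inj /esym].
  by rewrite -TE -kl TE => -[_ []]; apply: edge_rel_refl.
exists T; split.
  apply: bijective_surj TI _ => t.
  (* A maximal forest missing the [k]-th edge is contained in [R k]; as it spans and [R k] is
     bridged, the two coincide. *)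
  have [x [y [Cxy nxy]]] := cycle_missing t cC.
  have [k r] := iffLR (cE _ _) Cxy; exists k.
  have [sT aT bT cT] := edges_spanning t.
  have tR u v : edges t u v -> R k u v.
    move=> tuv; split; first exact: aT.
    move=> r'; apply: nxy; apply: (edge_rel_sym sT r).
    exact: edge_rel_sym sT (edge_rel_flip r') tuv.
  apply: edges_inj => u v; rewrite TE; split=> [Ruv|/tR //].
  apply: contrapT => nuv; apply: (bR k _ _ Ruv).
  apply: conn_sub (cT _ _ (proj1 Ruv)) => p q tpq; split; first exact: tR.
  by move=> r'; apply: nuv; apply: edge_rel_sym sT (edge_rel_flip r') tpq.
move=> k l; split=> [kl|+ kl]; last by rewrite kl => /adj_irrefl.
apply/forest_adjP; exists (c l), (c (ordS l)), (c k), (c (ordS k)); rewrite !TE; split.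
- by split; [apply: sub_edge_adj (Ce l) | move=> /edge_inj].
- exact: sub_edge_adj (Ce k).
- by move=> [_ []]; apply: edge_rel_refl.
move=> x y; split=> [[xy nl]|[[[xy nk] nl]|r]].
- case: (pselect (edge_rel (c k) (c (ordS k)) x y)) => [?|nk]; first by right.
  by left.
- by [].
split; first exact: edge_rel_sym sG r (sub_edge_adj (Ce k)).
move=> r'; apply: kl; apply/esym/edge_inj.
by case: r r' => [[-> ->]|[-> ->]] // r'; apply: edge_relC.
Qed.

(** An injective cycle in three vertices passes through all of them, and so uses all three edges. *)
Lemma K3_unique_triangle : unique_triangle K3.
Proof.
pose C := @Subgraph K3 (fun=> True) _ (@adj_sym K3) (fun _ _ H => H)
  (fun _ _ _ => conj I I).
have ordSE (i j : 'I_3) : i <> j -> exists k, edge_rel k (ordS k) i j.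
  case: (ord3P i) => ->; case: (ord3P j) => -> // _.
  - by exists ord0; left; split=> //; apply: val_inj.
  - by exists ord32; right; split=> //; apply: val_inj.
  - by exists ord0; right; split=> //; apply: val_inj.
  - by exists ord31; left; split=> //; apply: val_inj.
  - by exists ord32; left; split=> //; apply: val_inj.
  - by exists ord31; right; split=> //; apply: val_inj.
have C3 : cycle_of_length 3 C.
  split=> //; exists id; split=> // [x|x y]; first by split=> // _; exists x.
  split=> [/ordSE //|[k r]]; apply: (edge_rel_sym (@adj_sym K3) r).
  by case: (ord3P k) => -> /(congr1 val).
exists C; split=> // C' [n [n2 [c [cI cV cE]]]].
have n3 : n = 3.
  by apply/eqP; rewrite eqn_leq n2 andbT; have := leq_card c cI; rewrite !card_ord.
subst n; have [d cK dK] := injF_bij cI.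
apply: subgraph_ext => [x|x y]; first by split=> // _; apply/cV; exists (d x).
split=> [/sub_edge_adj //|xy]; apply/cE.
have dxy : d x <> d y by move=> /(can_inj dK).
have [k r] := ordSE _ _ dxy; exists k.
by have := edge_rel_map c r; rewrite !dK.
Qed.

Lemma iter_stable (G K : graph) :
  isomorphic (forest_graph G) K -> isomorphic (forest_graph K) K ->
  forall n, isomorphic (iter_forest_graph n.+1 G) K.
Proof.
move=> GK KK; elim=> // n IH.
exact: isomorphic_trans (forest_graph_iso IH) KK.
Qed.

(** [K1] is acyclic and [K3] has a triangle as its only cycle, so each is isomorphic to its own
    forest graph. *)
Lemma good_stable (G : graph) : acyclic G \/ unique_triangle G ->
  exists K, forall n, isomorphic (iter_forest_graph n.+1 G) K.
Proof.
case=> [/acyclic_forest_graph GK|/triangle_forest_graph GK].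
  by exists K1; apply: iter_stable GK (acyclic_forest_graph K1_acyclic).
exists K3; apply: iter_stable; apply: isomorphic_sym => //.
exact: triangle_forest_graph K3_unique_triangle.
Qed.

(** Otherwise there is a cycle of length at least 4, or a triangle together with a second cycle. *)
Lemma convergent_good (G : graph) :
  F_convergent G -> acyclic G \/ unique_triangle G.
Proof.
move=> conv; apply: contrapT => /not_orP [nac ntri]; apply: divergent conv.
have [C cC] : exists C : subgraph G, is_cycle C.
  by apply: contrapT => nex; apply: nac => C cC; apply: nex; exists C.
have [n Cn] := cC; case: (ltnP 3 n) => [|n3]; first exact: long_cycle_nullity Cn.
have e3 : n = 3 by apply/eqP; rewrite eqn_leq n3; case: Cn.
subst n; apply: nullity_forest; apply: contrapT => n2; apply: ntri; exists C.
split=> // C' cC'; apply: contrapT => CC'; apply: n2.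
exact: two_cycles_nullity cC' cC CC'.
Qed.

Theorem theorem5p3 (G : graph) :
  (F_convergent G <->
     acyclic G \/
     exists C : subgraph G,
       cycle_of_length 3 C /\ forall C' : subgraph G, is_cycle C' -> C' = C) /\
  (F_convergent G ->
     forall n : nat, 2 <= n ->
       isomorphic (iter_forest_graph n G) (iter_forest_graph 2 G)).
Proof.
split; last first.
  move=> /convergent_good /good_stable [K stab] [//|n] _.
  exact: isomorphic_trans (stab n) (isomorphic_sym (stab 1)).
split; first exact: convergent_good.
move=> /good_stable [K stab].
(* All iterates from the first on are isomorphic to [K]; only [G] itself may need its own
   representative. *)
exists 2, (fun i : 'I_2 => if i == ord0 then G else K) => -[|n].
  by exists ord0; apply: isomorphic_refl.
by exists ord_max; apply: stab.
Qed.
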